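(* For every integer $m\geq 7$, there exists an abelian Lie subalgebra of $\mathfrak{sl}_m(\mathbb{R})$ of dimension $m-1$, contained in a Borel subalgebra, which is not a limit of Cartan subspaces of $\mathfrak{sl}_m(\mathbb{R})$.
   Context: A Cartan subspace of $\mathfrak{sl}_m(\mathbb{R})$ is a conjugate under $\mathrm{SL}_m(\mathbb{R})$ of the subalgebra of trace-zero diagonal matrices. A Borel subalgebra of $\mathfrak{sl}_m(\mathbb{R})$ is a conjugate under $\mathrm{SL}_m(\mathbb{R})$ of the subalgebra of trace-zero upper triangular matrices. Limits are taken in the Grassmannian $\mathcal{G}r_{m-1}(\mathfrak{sl}_m(\mathbb{R}))$ of $(m-1)$-dimensional real subspaces, with its usual (analytic) topology. *)

(* Defs.v *)
From HB Require Import structures.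
From mathcomp Require Import all_boot all_order all_algebra.
From mathcomp Require Import boolp classical_sets reals topology normedtype sequences.

Set Implicit Arguments.
Unset Strict Implicit.
Unset Printing Implicit Defensive.

Import Order.TTheory GRing.Theory Num.Theory.
Import numFieldNormedType.Exports.

Local Open Scope classical_set_scope.
Local Open Scope ring_scope.

Section Grassmannian.
Variables (R : realType) (n k : nat) (E : {vspace 'M[R]_n}).

Record grassmannian := Grassmannian {
  gr_space :> {vspace 'M[R]_n};
  gr_spaceP : (gr_space <= E)%VS && (\dim gr_space == k) }.

HB.instance Definition _ := [isSub for gr_space].
HB.instance Definition _ := [Choice of grassmannian by <:].

Definition tuples := prod_topology (fun _ : 'I_k => 'M[R]_n).

(* The bases of the members of U. *)
Definition frames (U : set grassmannian) : set tuples :=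
  [set X | exists2 V : grassmannian, U V & basis_of V [tuple X i | i < k]].

(* The quotient topology for the map sending a linearly independent k-tuple
   of elements of E to its span: U is open when its preimage is relatively
   open in the set of all such tuples. *)
Definition gr_open (U : set grassmannian) : Prop :=
  open (frames U : set (subspace (frames setT))).

Lemma gr_openT : gr_open setT.
Proof. exact: open_subspaceT. Qed.

Lemma gr_openI : setI_closed gr_open.
Proof.
move=> U U' oU oU'; rewrite /gr_open.
have -> : frames (U `&` U') = frames U `&` frames U'.
  apply/seteqP; split=> [X [V [UV U'V] bX]|X [[V UV bV] [V' U'V' bV']]].
    by split; exists V.
  exists V => //; split=> //; suff -> : V = V' by [].
  by apply: val_inj; rewrite /= -(span_basis bV) -(span_basis bV').
exact: openI.
Qed.

Lemma gr_open_bigU (I : Type) (f : I -> set grassmannian) :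
  (forall i, gr_open (f i)) -> gr_open (\bigcup_i f i).
Proof.
move=> of_; rewrite /gr_open.
have -> : frames (\bigcup_i f i) = \bigcup_i frames (f i).
  apply/seteqP; split=> [X [V [i _ fV] bX]|X [i _ [V fV bX]]].
    by exists i => //; exists V.
  by exists V => //; exists i.
by apply: bigcup_open => i _; exact: of_.
Qed.

HB.instance Definition _ :=
  isOpenTopological.Build grassmannian gr_openT gr_openI gr_open_bigU.

Definition is_limit_of (S : set grassmannian) (V : grassmannian) : Prop :=
  exists2 u : nat -> grassmannian, (forall i, S (u i)) & u @ \oo --> V.

End Grassmannian.

Section SpecialLinear.
Variables (R : realType) (m : nat).
Implicit Type V : {vspace 'M[R]_m}.

Definition sl : {vspace 'M[R]_m} := lker (linfun (fun A : 'M[R]_m => \tr A : R^o)).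

Lemma mem_sl (A : 'M[R]_m) : (A \in sl) = (\tr A == 0).
Proof. by rewrite memv_ker lfunE. Qed.

Definition lie_bracket (A B : 'M[R]_m) : 'M[R]_m := A *m B - B *m A.

Definition lie_subalgebra V : Prop :=
  (V <= sl)%VS /\ {in V &, forall A B, lie_bracket A B \in V}.

Definition abelian_lie V : Prop := {in V &, forall A B, lie_bracket A B = 0}.

Definition sl_diag : set 'M[R]_m := [set A | A \in sl /\ is_diag_mx A].

(* is_trig_mx means lower triangular. *)
Definition sl_upper : set 'M[R]_m := [set A | A \in sl /\ is_trig_mx A^T].

Definition SL_conjugate (S T : set 'M[R]_m) : Prop :=
  exists2 g : 'M[R]_m, \det g = 1 & T = [set g *m A *m invmx g | A in S].

Definition cartan_subspace V : Prop := SL_conjugate sl_diag [set` V].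

Definition borel_subalgebra V : Prop := SL_conjugate sl_upper [set` V].

End SpecialLinear.

Arguments sl : clear implicits.

(* Main.v *)
Require Import Defs.
From HB Require Import structures.
From mathcomp Require Import all_boot all_order all_algebra.
From mathcomp Require Import boolp classical_sets reals topology normedtype sequences.
From mathcomp Require Import zify.
Import Order.TTheory GRing.Theory Num.Theory.
Import numFieldNormedType.Exports.
Local Open Scope classical_set_scope.
Local Open Scope ring_scope.

Set Implicit Arguments.
Unset Strict Implicit.
Unset Printing Implicit Defensive.

(** A conjugate [C] of the trace-zero diagonal matrices is stable under the
    trace-free square [Y |-> Y^2 - (tr (Y^2) / m) 1], because [C] and the
    identity together span an associative algebra ([cartan_tf_square]).
    Stability of a subspace under a continuous map is a closed condition in
    the Grassmannian ([limit_stable]), so every limit of Cartan subspaces is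
    stable under the trace-free square as well.

    It is therefore enough to find an abelian space of dimension [m - 1] of
    strictly upper triangular matrices, one of which has its square outside
    the space; strictly upper triangular squares have trace zero.  With
    indices starting at 0, take the span of [N = E_02 + E_23], of [E_04], and of
    the matrices [E_1j] for [3 <= j < m].  All pairwise products of these
    generators vanish except [N^2 = E_03], which does not lie in the span.
    The space needs a column of index 4, that is [m >= 5].

    The closedness of stability reduces to linear independence being an open
    condition.  If [f Y] lies outside [W] for some [Y] in [W], write
    [Y = sum_j a_j X_j] in a basis [X] of [W]; then [f (sum_j a_j X_j)]
    together with [X] is an independent family, and it stays independent when
    [X] moves a little while the coefficients [a] are kept fixed. *)

(** * Entrywise continuity of matrix-valued maps *)

Section EntrywiseContinuity.
Context {R : realType} {T : topologicalType}.

(** Entrywise continuity reduces sums, products and determinants of matrices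
    to sums and products of continuous scalar functions. *)
Definition mx_continuous {p q} (F : T -> 'M[R]_(p, q)) : Prop :=
  forall i j, continuous (fun x => F x i j).

Lemma continuous_sumr (I : finType) (F : I -> T -> R) :
  (forall i, continuous (F i)) -> continuous (fun x => \sum_i F i x).
Proof. by move=> cF; apply: (continuous_big add_continuous). Qed.

Lemma continuous_mulr (f g : T -> R) :
  continuous f -> continuous g -> continuous (fun x => f x * g x).
Proof. by move=> cf cg x; apply: cvgM; [exact: cf | exact: cg]. Qed.

Lemma mx_continuous_cst p q (A : 'M[R]_(p, q)) : mx_continuous (fun=> A).
Proof. by move=> i j x; apply: cvg_cst. Qed.

Lemma mx_continuousB p q (F G : T -> 'M[R]_(p, q)) :
  mx_continuous F -> mx_continuous G -> mx_continuous (fun x => F x - G x).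
Proof.
move=> cF cG i j x; under eq_fun do rewrite !mxE.
by apply: cvgB; [exact: cF | exact: cG].
Qed.

Lemma mx_continuousM p q r (F : T -> 'M[R]_(p, q)) (G : T -> 'M[R]_(q, r)) :
  mx_continuous F -> mx_continuous G -> mx_continuous (fun x => F x *m G x).
Proof.
move=> cF cG i j; under eq_fun do rewrite mxE.
by apply: continuous_sumr => k; exact: continuous_mulr.
Qed.

Lemma mx_continuousZ p q (c : T -> R) (F : T -> 'M[R]_(p, q)) :
  continuous c -> mx_continuous F -> mx_continuous (fun x => c x *: F x).
Proof.
move=> cc cF i j; under eq_fun do rewrite mxE.
exact: continuous_mulr.
Qed.

Lemma mx_continuous_sum (I : finType) p q (F : I -> T -> 'M[R]_(p, q)) :
  (forall k, mx_continuous (F k)) -> mx_continuous (fun x => \sum_k F k x).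
Proof.
move=> cF i j; under eq_fun do rewrite summxE.
by apply: continuous_sumr => k; exact: cF.
Qed.

Lemma continuous_trace n (F : T -> 'M[R]_n) :
  mx_continuous F -> continuous (fun x => \tr (F x)).
Proof. by move=> cF; apply: continuous_sumr => i; exact: cF. Qed.

Lemma continuous_det n (F : T -> 'M[R]_n) :
  mx_continuous F -> continuous (fun x => \det (F x)).
Proof.
move=> cF; apply: continuous_sumr => s; apply: continuous_mulr.
  by move=> x; apply: cvg_cst.
by apply: (continuous_big mul_continuous) => i _; exact: cF.
Qed.

End EntrywiseContinuity.

(** * Linear independence is an open condition *)

Section OpenFreeness.
Variables (R : realType) (n : nat).

Definition coord_mx {k} (X : 'I_k -> 'M[R]_n) : 'M[R]_(k, n * n) :=
  \matrix_(i < k) mxvec (X i).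

Lemma mul_coord_mx k (X : 'I_k -> 'M[R]_n) (c : 'rV_k) :
  c *m coord_mx X = mxvec (\sum_i c 0 i *: X i).
Proof.
by rewrite mulmx_sum_row linear_sum; apply: eq_bigr => i _; rewrite rowK linearZ.
Qed.

(** Independence is expressed by the nonvanishing of a determinant that is
    polynomial in the family.  A family is independent exactly when its matrix
    of coordinates has a right inverse, and such an inverse can serve as [B]. *)
Lemma free_minorP k (X : 'I_k -> 'M[R]_n) :
  free [tuple X i | i < k] <->
  exists B : 'M[R]_(n * n, k), \det (coord_mx X *m B) != 0.
Proof.
split=> [/freeP Xfree | [B detB]].
  have /row_freeP[B XB] : row_free (coord_mx X).
    apply: inj_row_free => c; rewrite mul_coord_mx => /eqP.
    rewrite mxvec_eq0 => /eqP c0; apply/rowP => i; rewrite mxE.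
    apply: (Xfree (c 0)); rewrite -[RHS]c0; apply: eq_bigr => j _.
    by rewrite -tnth_nth tnth_mktuple.
  by exists B; rewrite XB det1 oner_neq0.
apply/freeP => c c0 i.
suff : \row_j c j = 0 :> 'rV[R]_k by move=> /rowP/(_ i); rewrite !mxE.
have unitXB : coord_mx X *m B \in unitmx by rewrite unitmxE unitfE.
rewrite -[LHS](mulmxK unitXB) mulmxA mul_coord_mx.
suff -> : \sum_j (\row_j c j) 0 j *: X j = 0 by rewrite linear0 !mul0mx.
rewrite -[RHS]c0; apply: eq_bigr => j _.
by rewrite mxE -tnth_nth tnth_mktuple.
Qed.

Lemma open_free (T : topologicalType) k (F : 'I_k -> T -> 'M[R]_n) :
  (forall i, mx_continuous (F i)) ->
  open [set x | free [tuple F i x | i < k]].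
Proof.
move=> cF.
have -> : [set x | free [tuple F i x | i < k]] =
    \bigcup_B ((fun x => \det (coord_mx (F^~ x) *m B)) @^-1` [set y | y != 0]).
  apply/seteqP; split=> x /=.
    by move=> /free_minorP[B detB]; exists B.
  by move=> [B _ detB]; apply/free_minorP; exists B.
apply: bigcup_open => B _; apply: open_comp; last exact: open_neq.
move=> x _; apply: continuous_det; apply: mx_continuousM => [i j|].
  case/mxvec_indexP: j => p q.
  by under eq_fun do rewrite mxE mxvecE; exact: cF.
exact: mx_continuous_cst.
Qed.

End OpenFreeness.

(** * Stability under a continuous map is closed in the Grassmannian *)

Section UnstableSubspaces.
Variables (R : realType) (n k : nat) (E : {vspace 'M[R]_n}).
Variable f : 'M[R]_n -> 'M[R]_n.
Hypothesis f_continuous : forall (T : topologicalType) (F : T -> 'M[R]_n),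
  mx_continuous F -> mx_continuous (fun x => f (F x)).

Definition unstable : set (grassmannian k E) :=
  [set W | exists2 Y, Y \in gr_space W & f Y \notin gr_space W].

(** The coefficients [a] stay fixed while the family [X] varies, so that each
    member of the extended family is a continuous function of [X]. *)
Let extend (a : 'rV[R]_k) (i : 'I_k.+1) (X : tuples R n k) : 'M[R]_n :=
  if unlift ord0 i is Some j then X j else f (\sum_j a 0 j *: X j).

Let extendE a X : [tuple extend a i X | i < k.+1] =
  f (\sum_j a 0 j *: X j) :: [tuple X i | i < k] :> seq _.
Proof.
rewrite /= enum_ordSl /= {1}/extend unlift_none -map_comp; congr (_ :: _).
by apply: eq_map => i /=; rewrite /extend liftK.
Qed.

(** The frames of the unstable subspaces are the frames [X] for which some
    coefficient vector [a] makes [extend a] independent at [X]; for each fixed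
    [a] this is an open condition on [X]. *)
Lemma open_unstable : open unstable.
Proof.
pose O := \bigcup_a [set X | free [tuple extend a i X | i < k.+1]].
have oO : open O.
  apply: bigcup_open => a _; apply: open_free => i; rewrite /extend.
  have cproj j : mx_continuous (fun X : tuples R n k => X j).
    move=> p q X; apply: (@continuous_comp _ _ _
      (fun X : tuples R n k => X j) (fun A : 'M[R]_n => A p q)).
      exact: (@proj_continuous _ (fun _ : 'I_k => 'M[R]_n) j).
    exact: coord_continuous.
  case: unlift => [j|]; first exact: cproj.
  apply: (@f_continuous _ (fun X : tuples R n k => \sum_j a 0 j *: X j)).
  apply: (@mx_continuous_sum R (tuples R n k) _ n n (fun j X => a 0 j *: X j)) => j.
  apply: (mx_continuousZ (c := fun=> a 0 j)); last exact: cproj.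
  exact: cst_continuous.
(* The topology of the Grassmannian is by definition the one of its frames. *)
change (open (@frames R n k E unstable : set (subspace (@frames R n k E setT)))).
apply/open_subspaceP; exists O => //; apply/seteqP; split=> X [].
  move=> [a _ /=]; rewrite extendE free_cons => /andP[faX _] [W _ bW].
  split; last by exists W.
  exists W => //; exists (\sum_j a 0 j *: X j).
    rewrite memv_suml // => j _; rewrite memvZ // (basis_mem bW) //.
    by apply/mapP; exists j; rewrite ?mem_enum.
  by rewrite -(span_basis bW).
move=> [W [Y YW fY] bW] XT; split=> //.
exists (\row_j coord [tuple X i | i < k] j Y) => //=.
rewrite extendE free_cons (basis_free bW) andbT (span_basis bW).
suff -> : \sum_j (\row_j coord [tuple X i | i < k] j Y) 0 j *: X j = Y by [].
rewrite [RHS](coord_basis bW YW); apply: eq_bigr => j _.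
by rewrite mxE -tnth_nth tnth_mktuple.
Qed.

Lemma limit_stable (S : set (grassmannian k E)) (V : grassmannian k E) :
  (forall W, S W -> {in gr_space W, forall Y, f Y \in gr_space W}) ->
  is_limit_of S V -> {in gr_space V, forall Y, f Y \in gr_space V}.
Proof.
move=> Sf [u uS uV] Y YV; apply/negPn/negP => fY.
have /filter_ex[i [Z Zi]] : \forall i \near \oo, unstable (u i).
  apply: uV; apply: open_nbhs_nbhs.
  by split; [exact: open_unstable | exists Y].
by rewrite (Sf _ (uS i)).
Qed.

End UnstableSubspaces.

(** * Cartan subspaces are stable under the trace-free square *)

Section TraceFreeSquare.
Variables (R : realType) (n : nat).

(** The projection of [Y^2] to the trace-zero matrices along the scalar
    matrices. *)
Definition tf_square (Y : 'M[R]_n) : 'M[R]_n :=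
  Y *m Y - (\tr (Y *m Y) / n%:R) *: 1%:M.

Lemma tf_square_continuous (T : topologicalType) (F : T -> 'M[R]_n) :
  mx_continuous F -> mx_continuous (fun x => tf_square (F x)).
Proof.
move=> cF; have cFF := mx_continuousM cF cF.
apply: (mx_continuousB cFF); apply: mx_continuousZ.
  apply: continuous_mulr; first exact: (continuous_trace cFF).
  exact: cst_continuous.
exact: mx_continuous_cst.
Qed.

(** The trace-free square commutes with conjugation, and the square of a
    diagonal matrix is diagonal. *)
Lemma cartan_tf_square (W : {vspace 'M[R]_n}) :
  (0 < n)%N -> cartan_subspace W -> {in W, forall Y, tf_square Y \in W}.
Proof.
move=> n_gt0 [g detg WE] Y YW.
have ug : g \in unitmx by rewrite unitmxE detg unitr1.
have [A [_ diagA] <-] : [set g *m A *m invmx g | A in @sl_diag R n] Y.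
  by rewrite -WE.
suff : [set` W] (tf_square (g *m A *m invmx g)) by [].
have sqE : g *m A *m invmx g *m (g *m A *m invmx g) = g *m (A *m A) *m invmx g.
  by rewrite !mulmxA mulmxKV.
have trE : \tr (g *m (A *m A) *m invmx g) = \tr (A *m A).
  by rewrite mxtrace_mulC mulKmx.
rewrite WE; exists (tf_square A); last first.
  rewrite /tf_square sqE trE mulmxBr mulmxBl -scalemxAr -scalemxAl mulmx1.
  by rewrite mulmxV.
split.
  rewrite mem_sl raddfB /= mxtraceZ mxtrace1 divfK ?subrr //.
  by rewrite pnatr_eq0 -lt0n.
have /diag_mxP[d ->] := diagA; rewrite /tf_square mulmx_diag.
apply/is_diag_mxP => i j ij; rewrite !mxE -val_eqE (negPf ij).
by rewrite !mulr0n mulr0 subrr.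
Qed.

End TraceFreeSquare.

(** * The standard Borel subalgebra *)

Section UpperTriangular.
Variables (R : realType) (m : nat).

Definition below_diag (A : 'M[R]_m) : 'M[R]_m :=
  \matrix_(i, j) if (j < i)%N then A i j else 0.

Lemma below_diag_linear : linear below_diag.
Proof.
move=> a A B; apply/matrixP => i j; rewrite !mxE.
by case: ifP => _ //; rewrite mulr0 addr0.
Qed.

HB.instance Definition _ :=
  GRing.isLinear.Build R 'M[R]_m 'M[R]_m *:%R below_diag below_diag_linear.

Definition std_borel : {vspace 'M[R]_m} := (sl R m :&: lker (linfun below_diag))%VS.

Lemma mem_std_borel A : (A \in std_borel) = (A \in sl R m) && is_trig_mx A^T.
Proof.
rewrite memv_cap; congr (_ && _); rewrite memv_ker lfunE.
apply/eqP/is_trig_mxP => [A0 i j ij | A0].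
  by have /matrixP/(_ j i) := A0; rewrite !mxE ij.
by apply/matrixP => i j; rewrite !mxE; case: ifP => // /A0; rewrite mxE.
Qed.

Lemma std_borelP : borel_subalgebra std_borel.
Proof.
exists 1%:M; first exact: det1.
apply/seteqP; split=> A /=.
  rewrite mem_std_borel => /andP[slA trA]; exists A => //.
  by rewrite invmx1 mul1mx mulmx1.
move=> [B [slB trB] <-]; rewrite invmx1 mul1mx mulmx1.
by rewrite mem_std_borel slB.
Qed.

End UpperTriangular.

(** * An abelian space not stable under the trace-free square *)

Section Example.
Variables (R : realType) (p : nat).
Hypothesis p_ge3 : (3 <= p)%N.

(** With [c_k] the entries of [v], this is
    [c_0 (E_02 + E_23) + c_1 E_04 + sum_(3 <= j) c_(j-1) E_1j]: column [j] of
    row 1 uses [c_(j-1)], so that the indices 2, ..., p remaining after [c_0]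
    and [c_1] match the columns 3, ..., p + 1 exactly. *)
Definition nonlimit_mx (v : 'rV[R]_p.+1) : 'M[R]_p.+2 := \matrix_(i, j)
  match val i with
  | 0 => if val j == 2 then v 0 (inord 0)
         else if val j == 4 then v 0 (inord 1) else 0
  | 1 => if (3 <= val j)%N then v 0 (inord (val j).-1) else 0
  | 2 => if val j == 3 then v 0 (inord 0) else 0
  | _ => 0
  end.

Lemma nonlimit_mx_linear : linear nonlimit_mx.
Proof.
move=> a u v; apply/matrixP => -[[|[|[|i]]] ?] j; rewrite !mxE //=;
  by do ?case: ifP => _; rewrite ?mulr0 ?addr0.
Qed.

HB.instance Definition _ :=
  GRing.isLinear.Build R 'rV[R]_p.+1 'M[R]_p.+2 *:%R nonlimit_mx nonlimit_mx_linear.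

Definition nonlimit_space : {vspace 'M[R]_p.+2} := limg (linfun nonlimit_mx).

Lemma nonlimit_spaceP A : reflect (exists v, A = nonlimit_mx v) (A \in nonlimit_space).
Proof.
apply: (iffP memv_imgP) => [[v _ ->] | [v ->]]; exists v; rewrite ?lfunE //.
exact: memvf.
Qed.

Lemma dim_nonlimit_space : \dim nonlimit_space = p.+1.
Proof.
rewrite limg_dim_eq; first by rewrite dimvf /dim /= mul1n.
apply/eqP; rewrite -subv0; apply/subvP => v; rewrite memv_cap memv_ker lfunE /=.
move=> /andP[_ /eqP/matrixP v0]; rewrite memv0; apply/eqP/rowP => j.
rewrite [RHS]mxE -[j]inord_val; case: j => -[|[|j]] jp /=.
- by have := v0 (inord 0) (inord 2); rewrite !mxE /= !inordK //; lia.
- have := v0 (inord 0) (inord 4); rewrite !mxE /= !inordK //; lia.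
- have := v0 (inord 1) (inord j.+3); rewrite !mxE /= !inordK //; lia.
Qed.

(** Nonzero entries lie in columns of index at least 2 and in rows of index at
    most 2, so a product only sees the inner index 2: column 2 is supported on
    row 0, and row 2 on column 3.  The resulting coefficient is symmetric in
    [u] and [v], whence commutativity. *)
Lemma nonlimit_mxM u v : nonlimit_mx u *m nonlimit_mx v =
  (u 0 (inord 0) * v 0 (inord 0)) *: delta_mx (inord 0) (inord 3).
Proof.
have p2 : (2 < p.+2)%N by lia.
apply/matrixP => i j; rewrite mxE (bigD1 (Ordinal p2)) //= big1 => [|k k2].
  rewrite addr0 !mxE -!val_eqE /= !inordK ?ltnS //=; last by lia.
  case: i => [[|[|[|i]]] ?] /=; rewrite ?mul0r ?mulr0 //.
  by case: eqP; rewrite ?mulr0 ?mulr1.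
rewrite !mxE; case: k i k2 => [[|[|[|k]]] ?] [[|[|[|i]]] ?] //=;
  rewrite ?mul0r ?mulr0 //.
Qed.

Lemma nonlimit_abelian : {in nonlimit_space &, forall A B, lie_bracket A B = 0}.
Proof.
move=> _ _ /nonlimit_spaceP[u ->] /nonlimit_spaceP[v ->].
by rewrite /lie_bracket !nonlimit_mxM mulrC subrr.
Qed.

Lemma nonlimit_sub_borel : (nonlimit_space <= std_borel R p.+2)%VS.
Proof.
apply/subvP => _ /nonlimit_spaceP[v ->]; rewrite mem_std_borel mem_sl.
apply/andP; split.
  by apply/eqP/big1 => -[[|[|[|i]]] ?] _; rewrite mxE.
apply/is_trig_mxP => i j; rewrite !mxE.
by case: i j => [[|[|[|i]]] ?] [[|[|[|j]]] ?].
Qed.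

(** The witness is [N = E_02 + E_23]: its square [E_03] has trace zero, and
    every matrix in the space vanishes at position (0, 3). *)
Lemma nonlimit_tf_square :
  exists2 Y, Y \in nonlimit_space & tf_square Y \notin nonlimit_space.
Proof.
exists (nonlimit_mx (delta_mx 0 (inord 0))).
  by apply/nonlimit_spaceP; eexists.
have ord3 : (inord 3 : 'I_p.+2) = 3 :> nat by rewrite inordK //; lia.
have sqE : tf_square (nonlimit_mx (delta_mx 0 (inord 0))) = delta_mx (inord 0) (inord 3).
  rewrite /tf_square nonlimit_mxM !mxE !eqxx mulr1 scale1r.
  suff -> : \tr (delta_mx (inord 0) (inord 3) : 'M[R]_p.+2) = 0.
    by rewrite mul0r scale0r subr0.
  apply: big1 => i _; rewrite mxE -!val_eqE /= ord3 inordK //=.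
  by case: i => [[|i] ?].
rewrite sqE; apply/negP => /nonlimit_spaceP[v /matrixP/(_ (inord 0) (inord 3))].
by rewrite !mxE !eqxx /= ord3 inordK //= => /eqP; rewrite oner_eq0.
Qed.

End Example.

Theorem mainTheorem6 (R : realType) (m : nat) (hm : (7 <= m)%N) :
  exists V : grassmannian m.-1 (sl R m),
    [/\ lie_subalgebra V,
        abelian_lie V,
        (exists2 b : {vspace 'M[R]_m}, borel_subalgebra b & (V <= b)%VS) &
        ~ is_limit_of [set C : grassmannian m.-1 (sl R m) | cartan_subspace C] V].
Proof.
case: m hm => [|[|p]] // hp; have p3 : (3 <= p)%N by lia.
have Vsl : (nonlimit_space R p <= sl R p.+2)%VS.
  exact: subv_trans (nonlimit_sub_borel R p) (capvSl _ _).
have VP : (nonlimit_space R p <= sl R p.+2)%VS && (\dim (nonlimit_space R p) == p.+2.-1).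
  by rewrite Vsl dim_nonlimit_space /=.
exists (Grassmannian VP); split=> /=.
- by split=> // A B AV BV; rewrite nonlimit_abelian ?mem0v.
- exact: nonlimit_abelian.
- by exists (std_borel R p.+2); [exact: std_borelP | exact: nonlimit_sub_borel].
- move=> /(limit_stable (@tf_square_continuous R p.+2)) stable.
  have [Y YV /negP] := nonlimit_tf_square R p3; apply.
  apply: stable YV => W; exact: cartan_tf_square.
Qed.
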